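(* Let $\mathbb K$ be a field of characteristic $0$, and let $\Sigma=(\ell_1,\ldots,\ell_n)$ be a collection of (nonzero) linear forms in $R=\mathbb K[x,y]$, some possibly proportional. Then, for any $1\leq a\leq n$, the ideal $I_a(\Sigma)$ has linear graded free resolution.
   Context: $R$ has the standard grading. $\Sigma$ is a collection with repetitions allowed, $|\Sigma|=n$. For $1\le a\le n$, $I_a(\Sigma)$ is the ideal of $R$ generated by all products $\ell_{i_1}\cdots\ell_{i_a}$ with $1\le i_1<\cdots<i_a\le n$. A homogeneous ideal $I\subset R$ generated in degree $d$ has linear graded free resolution if there is a graded free resolution of the form $0\rightarrow R^{n_{b+1}}(-(d+b))\rightarrow\cdots\rightarrow R^{n_2}(-(d+1))\rightarrow R^{n_1}(-d)\rightarrow R\rightarrow R/I\rightarrow 0$ for some positive integer $b$ (the ranks $n_i\ge 0$ are allowed to vanish, so that principal ideals qualify). By convention the zero ideal has linear graded free resolution. *)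

(* Defs.v *)
From HB Require Import structures.
From mathcomp Require Import all_boot all_order all_algebra.
From mathcomp.multinomials Require Import mpoly.
Set Implicit Arguments. Unset Strict Implicit. Unset Printing Implicit Defensive.
Import GRing.Theory.
Local Open Scope ring_scope.

Section GradedResolutions.
Variables (k : nat) (K : fieldType).
Local Notation R := {mpoly K[k]}.

(* Ideals are arbitrary subsets of [R], hence Prop-valued predicates:
   membership is not assumed decidable. *)
Definition ideal_gen (G : R -> Prop) (p : R) : Prop :=
  exists (m : nat) (c g : 'I_m -> R),
    (forall i, G (g i)) /\ p = \sum_(i < m) c i * g i.

Definition generated_in_degree (d : nat) (I : R -> Prop) : Prop :=
  exists G : R -> Prop,
    (forall g, G g -> g \is d.-homog) /\ (forall p, I p <-> ideal_gen G p).

(* [p] lies in the component of degree [e] of [R(-s)], i.e. in R_(e - s),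
   which is zero for [e < s]. *)
Definition shifted_homog (s e : nat) (p : R) : Prop :=
  if (s <= e)%N then is_true (p \is (e - s).-homog) else p = 0.

(* [v] lies in the component of degree [e] of R^m(-s). *)
Definition free_homog (s e m : nat) (v : 'rV[R]_m) : Prop :=
  forall j, shifted_homog s e (v 0 j).

(* [f] is a graded (degree-preserving) map R^m(-s) -> R^p(-t). *)
Definition graded_map (s t m p : nat) (f : 'rV[R]_m -> 'rV[R]_p) : Prop :=
  forall e v, free_homog s e v -> free_homog t e (f v).

(* [f] is a graded map R^m(-s) -> R. *)
Definition graded_augmentation (s m : nat) (f : 'rV[R]_m -> R^o) : Prop :=
  forall e v, free_homog s e v -> shifted_homog 0 e (f v).

(* The exact complex
     0 -> R^(rk b)(-(d+b)) -> ... -> R^(rk 1)(-(d+1)) -> R^(rk 0)(-d)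
       -> R -> R/I -> 0,
   with [rk i] the rank written n_(i+1) in the usual display.  It is extended
   by zero modules to the left of position [b], so that exactness at position
   [b] is injectivity of the leftmost map.  Exactness at [R], where the next
   map is the canonical projection onto R/I, says that the image of [eps]
   is [I]. *)
Definition is_linear_resolution (I : R -> Prop) (d b : nat) (rk : nat -> nat)
    (eps : {linear 'rV[R]_(rk 0%N) -> R^o})
    (phi : forall i : nat, {linear 'rV[R]_(rk i.+1) -> 'rV[R]_(rk i)}) : Prop :=
  [/\ forall i, (b < i)%N -> rk i = 0%N,
      graded_augmentation d eps
      /\ (forall i, graded_map (d + i.+1) (d + i) (phi i)),
      forall p, I p <-> exists v, eps v = p,
      forall v, eps v = 0 <-> exists w, phi 0%N w = v
    & forall i v, phi i v = 0 <-> exists w, phi i.+1 w = v].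

Definition has_linear_resolution (I : R -> Prop) : Prop :=
  (forall p, I p <-> p = 0)
  \/ exists d b : nat,
       [/\ generated_in_degree d I, (0 < b)%N
         & exists rk eps phi, @is_linear_resolution I d b rk eps phi].

Definition fold_product (n : nat) (Sigma : n.-tuple R) (a : nat) (g : R) : Prop :=
  exists A : {set 'I_n}, #|A| = a /\ g = \prod_(i in A) tnth Sigma i.

Definition fold_ideal (n : nat) (Sigma : n.-tuple R) (a : nat) : R -> Prop :=
  ideal_gen (fold_product Sigma a).

Definition linear_form (p : R) : Prop := p \is 1.-homog.

End GradedResolutions.

(* Main.v *)
Require Import Defs.
From HB Require Import structures.
From mathcomp Require Import all_boot all_order all_algebra ring.
From mathcomp.multinomials Require Import mpoly.
Set Implicit Arguments. Unset Strict Implicit. Unset Printing Implicit Defensive.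
Import GRing.Theory.
Local Open Scope ring_scope.

(** Let R = K[x, y], with R_e its forms of degree e, and m = (x, y).  The ideal I_a generated by the
    a-fold products of the linear forms is g m^r for some nonzero form g of
    degree d with d + r = a, and a form times a power of m has the linear
    resolution 0 -> R^r(-(a+1)) -> R^(r+1)(-a) -> R.

    The equality I_a = g m^r ([subset_ideal_gcd]) goes by induction on a, for
    all subfamilies B at once.  Suppose first that some form l_i of B divides
    every a-fold product.  By [linear_dvd] each such product then contains a
    factor proportional to l_i; replacing that factor by l_i gives
    I_a(B) = l_i I_(a-1)(B minus i), and the induction hypothesis applies.
    Otherwise, for each i in B some a-fold product P is not divisible by l_i,
    and then I_a(B) contains all forms of degree a ([subset_ideal_full]).
    This is again an induction: the hypothesis passes to B minus i with a - 1
    in place of a, so I_a(B) contains l_i R_(a-1).  That space has codimension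
    one in R_a, being the kernel of the evaluation at the zero of l_i, and P
    lies outside it; hence I_a(B) contains R_a.

    The resolution of g m^r ([multiple_of_power_resolution]) is the
    Hilbert-Burch one: the generators g x^j y^(r-j) have exactly the syzygies
    generated by those between neighbours, y (x^(k+1) y^(r-k-1)) =
    x (x^k y^(r-k)).  This only uses that x, y is a regular sequence
    ([power_syzygy]). *)

(** * Generated ideals *)

Section Ideals.
Variables (k : nat) (K : fieldType).
Local Notation R := {mpoly K[k]}.
Implicit Types (G J : R -> Prop) (p q : R).

Lemma ideal_gen_sub G J p :
  J 0 -> (forall p q, J p -> J q -> J (p + q)) ->
  (forall c q, G q -> J (c * q)) -> ideal_gen G p -> J p.
Proof.
move=> J0 JD JG [m [c [g [Gg ->]]]].
by apply: (big_ind J) => // i _; apply: JG.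
Qed.

Lemma ideal_genMl G c g : G g -> ideal_gen G (c * g).
Proof. by move=> Gg; exists 1%N, (fun=> c), (fun=> g); rewrite big_ord1. Qed.

Lemma ideal_gen0 G : ideal_gen G 0.
Proof. by exists 0%N, (fun=> 0), (fun=> 0); rewrite big_ord0; split=> // -[]. Qed.

Lemma ideal_genD G p q : ideal_gen G p -> ideal_gen G q -> ideal_gen G (p + q).
Proof.
move=> [m [c [g [Gg ->]]]] [m' [c' [g' [Gg' ->]]]].
exists (m + m')%N, (fun i => match split i with inl j => c j | inr j => c' j end),
  (fun i => match split i with inl j => g j | inr j => g' j end); split.
  by move=> i; case: split.
rewrite big_split_ord /=; congr (_ + _); apply: eq_bigr => i _.
  by rewrite (unsplitK (inl i)).
by rewrite (unsplitK (inr i)).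
Qed.

Lemma ideal_genM G c p : ideal_gen G p -> ideal_gen G (c * p).
Proof.
apply: (ideal_gen_sub (J := fun p => ideal_gen G (c * p))).
- by rewrite mulr0; apply: ideal_gen0.
- by move=> a b Ia Ib; rewrite mulrDr; apply: ideal_genD.
- by move=> b q Gq; rewrite mulrA; apply: ideal_genMl.
Qed.

End Ideals.

(** * Homogeneous polynomials *)

Section Forms.
Variables (n : nat) (K : fieldType).
Local Notation R := {mpoly K[n]}.

(** The step of inductions on the degree of a form: every monomial of
    positive degree is divisible by some variable. *)
Lemma dhomogS_split d (F : R) : F \is d.+1.-homog ->
  exists G : 'I_n -> R, (forall k, G k \is d.-homog) /\ F = \sum_k 'X_k * G k.
Proof.
move=> hF; rewrite [F]mpolyE big_seq.
apply: (big_ind (fun F : R => exists G : 'I_n -> R,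
  (forall k, G k \is d.-homog) /\ F = \sum_k 'X_k * G k)).
- exists (fun=> 0); split=> [k|]; first exact: dhomog0.
  by rewrite big1 // => k _; rewrite mulr0.
- move=> _ _ [G [hG ->]] [H [hH ->]]; exists (fun k => G k + H k); split=> [k|].
    exact: dhomogD.
  by rewrite -big_split; apply: eq_bigr => k _; rewrite mulrDr.
move=> m mF; have dm : mdeg m = d.+1 := dhomog_mf hF mF.
(* The monomial is charged to one variable k0 occurring in it. *)
have [k0 mk0] : exists k, (0 < m k)%N.
  apply/existsP; apply: contraTT isT; rewrite negb_exists => /forallP m0.
  move: dm; rewrite mdegE big1 // => k _.
  by move: (m0 k); rewrite lt0n negbK => /eqP.
have Um : (U_(k0) <= m)%MM by rewrite lep1mP -lt0n.
exists (fun k => if k == k0 then F@_m *: 'X_[m - U_(k0)] else 0); split=> [k|].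
  case: eqP => _; last exact: dhomog0.
  by apply: dhomogZ; rewrite dhomogX /= -eqSS -dm -{2}(submK Um) mdegD mdeg1 addn1.
rewrite (bigD1 k0) //= eqxx big1 ?addr0; last first.
  by move=> k /negPf ->; rewrite mulr0.
by rewrite -scalerAr -mpolyXD addmC submK.
Qed.

Lemma dhomog0_const (F : R) : F \is 0.-homog -> exists c, F = c%:MP.
Proof.
move=> hF; exists F@_0; apply: msize1_polyC.
rewrite msizeE; apply/bigmax_leqP_seq => m mF _.
by rewrite (dhomog_mf hF mF).
Qed.

Lemma dhomog_prod_lin (I : finType) (l : I -> R) (A : {set I}) :
  (forall i, l i \is 1.-homog) -> \prod_(i in A) l i \is #|A|.-homog.
Proof.
move=> hl; rewrite -sum1_card.
apply: (big_ind2 (fun (p : R) d => p \is d.-homog)) => //.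
  exact: dhomog1.
by move=> p d q e; apply: dhomogM.
Qed.

Lemma dhomogXi k : ('X_k : R) \is 1.-homog.
Proof. by rewrite dhomogX /= mdeg1. Qed.

End Forms.

(** * Divisibility of binary forms by a linear form *)

Section Division.
Variable K : fieldType.
Local Notation R := {mpoly K[2]}.
Implicit Types (F l : R).

(** A representative of the projective zero of [l]. *)
Definition zero_pt l (k : 'I_2) : K :=
  if k == 0 then l@_U_(1%R) else - l@_U_(0%R).

Lemma dhomog1E l : l \is 1.-homog ->
  l = (l@_U_(0%R))%:MP * 'X_0 + (l@_U_(1%R))%:MP * 'X_1.
Proof.
move=> /dhomogS_split[G [hG ->]].
have [a Ga] := dhomog0_const (hG 0); have [b Gb] := dhomog0_const (hG 1).
rewrite big_ord_recl big_ord1 (_ : lift ord0 ord0 = 1); last exact: val_inj.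
rewrite Ga Gb !mcoeffD ![_ * _%:MP]mulrC !mcoeffCM !mcoeffX !eqxx.
have /negPf -> : U_(1%R)%MM != U_(0%R)%MM :> 'X_{1..2}.
  by apply/eqP => /mnmP/(_ 0); rewrite !mnm1E.
have /negPf -> : U_(0%R)%MM != U_(1%R)%MM :> 'X_{1..2}.
  by apply/eqP => /mnmP/(_ 0); rewrite !mnm1E.
by rewrite !mulr0 !mulr1 addr0 add0r.
Qed.

(** Writing l = b x + c y, the zero of l is P = (c, -b), and P_x y - P_y x is l
    itself.  So modulo l the coordinates (x, y) are proportional to those
    of P. *)
Lemma zero_pt_cross l i k : l \is 1.-homog ->
  exists s : R, s \is 0.-homog /\
  (zero_pt l i)%:MP * 'X_k - (zero_pt l k)%:MP * 'X_i = l * s.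
Proof.
move=> /dhomog1E lE.
have h c : (c%:MP : R) \is 0.-homog.
  by rewrite -[c]mulr1 mpolyCM mul_mpolyC; apply: dhomogZ; exact: dhomog1.
have ord2 (j : 'I_2) : j = 0 \/ j = 1.
  by case: j => -[|[|]] // ?; [left|right]; apply: val_inj.
have [->|->] := ord2 i; have [->|->] := ord2 k; rewrite /zero_pt /=.
- by exists 0; split; [exact: dhomog0|rewrite mulr0 subrr].
- by exists 1%:MP; split=> //; rewrite [in RHS]lE mpolyCN; ring.
- by exists (-1)%:MP; split=> //; rewrite [in RHS]lE !mpolyCN; ring.
- by exists 0; split; [exact: dhomog0|rewrite mulr0 subrr].
Qed.

(** Modulo [l] one may replace each variable X_k by (P_k / P_i) X_i, where P
    is the zero of [l], so that F becomes F(P) (X_i / P_i)^deg F; clearing the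
    denominators gives an identity valid without assuming P_i nonzero. *)
Lemma eval_mod_linear l d F i : l \is 1.-homog -> F \is d.+1.-homog ->
  exists Q : R, Q \is d.-homog /\
  (zero_pt l i ^+ d.+1)%:MP * F - (F.@[zero_pt l])%:MP * 'X_i ^+ d.+1 = l * Q.
Proof.
move=> hl; set P := zero_pt l.
pose Phi e (F : R) : R := (P i ^+ e)%:MP * F - (F.@[P])%:MP * 'X_i ^+ e.
have PhiD e : {morph Phi e : p q / p + q}.
  by move=> p q; rewrite /Phi mevalD mpolyCD; ring.
have Phi0 e : Phi e 0 = 0 by rewrite /Phi meval0 mpolyC0 mulr0 mul0r subrr.
rewrite -/(Phi d.+1 F).
have red e (G : 'I_2 -> R) :
    (forall k, exists Q : R, Q \is e.-homog /\ Phi e.+1 ('X_k * G k) = l * Q) ->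
  exists Q : R, Q \is e.-homog /\ Phi e.+1 (\sum_k 'X_k * G k) = l * Q.
  move=> /fin_all_exists[Q hQ]; exists (\sum_k Q k); split.
    by apply: rpred_sum => k _; case: (hQ k).
  rewrite (big_morph _ (PhiD _) (Phi0 _)) mulr_sumr.
  by apply: eq_bigr => k _; case: (hQ k).
elim: d F => [|d IHd] F /dhomogS_split[G [hG ->]]; apply: red => k;
    have [s [hs es]] := zero_pt_cross i k hl.
  have [c ->] := dhomog0_const (hG k).
  exists (c%:MP * s); split; first by rewrite mul_mpolyC dhomogZ.
  rewrite /Phi mevalM mevalXU mevalC mpolyCM (mulrCA l) -es -/P.
  by rewrite !expr1; ring.
have [Q [hQ eQ]] := IHd _ (hG k).
exists ((P i)%:MP * 'X_k * Q + ((G k).@[P])%:MP * 'X_i ^+ d.+1 * s); split.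
  apply: dhomogD; rewrite -mulrA mul_mpolyC; apply: dhomogZ.
    by rewrite -[d.+1]add1n; apply: dhomogM => //; apply: dhomogXi.
  rewrite -[X in X.-homog]addn0; apply: dhomogM => //.
  by rewrite -[X in X.-homog]mul1n; apply: dhomogMn; apply: dhomogXi.
rewrite mulrDr !(mulrCA l) -eQ -es -/P /Phi mevalM mevalXU.
rewrite [P i ^+ d.+2]exprS ['X_i ^+ d.+2]exprS !mpolyCM.
set a := (P i)%:MP; set b := (P i ^+ d.+1)%:MP; set c := _%:MP; set e := _%:MP.
by set f := 'X_i ^+ _; ring.
Qed.

(** The factor theorem for binary forms: some coordinate P_i of the zero of
    [l] is invertible, and [eval_mod_linear] for this i gives the quotient. *)
Lemma linear_dvd l d F : l \is 1.-homog -> l != 0 -> F \is d.+1.-homog ->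
  F.@[zero_pt l] = 0 -> exists Q : R, Q \is d.-homog /\ F = l * Q.
Proof.
move=> hl l0 hF F0.
have [i Pi] : exists i, zero_pt l i != 0.
  apply/existsP; apply: contraNT l0; rewrite negb_exists => /forallP P0.
  move: (P0 0) (P0 1); rewrite /zero_pt /= !negbK oppr_eq0 => /eqP l1 /eqP l0.
  by rewrite (dhomog1E hl) l1 l0 !mul0r addr0.
have [Q [hQ]] := eval_mod_linear i hl hF.
rewrite F0 mul0r subr0 => eQ.
exists (((zero_pt l i ^+ d.+1)^-1)%:MP * Q).
rewrite mul_mpolyC dhomogZ //; split=> //; rewrite -mul_mpolyC mulrCA -eQ mulrA.
by rewrite -mpolyCM mulVf ?mul1r // expf_neq0.
Qed.

End Division.

(** * Ideals of products of linear forms *)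

Section SubsetProducts.
Variables (K : fieldType) (I : finType) (l : I -> {mpoly K[2]}).
Local Notation R := {mpoly K[2]}.
Hypotheses (lin_l : forall i, l i \is 1.-homog) (l_neq0 : forall i, l i != 0).
Implicit Types (A B : {set I}) (F g p Q : R).

Definition subset_product B e g : Prop :=
  exists A, [/\ A \subset B, #|A| = e & g = \prod_(j in A) l j].

(** By the factor theorem this says that [l i] does not divide every product of
    [e] forms taken from [B]; evaluation makes it a boolean, so that the proof
    can argue by cases. *)
Definition avoids B e i : bool :=
  [exists A : {set I}, [&& A \subset B, #|A| == e &
    (\prod_(j in A) l j).@[zero_pt (l i)] != 0]].

Lemma subset_ideal_step B e i p : i \in B ->
  ideal_gen (subset_product (B :\ i) e) p ->
  ideal_gen (subset_product B e.+1) (l i * p).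
Proof.
move=> iB; apply: (ideal_gen_sub
  (J := fun p => ideal_gen (subset_product B e.+1) (l i * p))).
- by rewrite mulr0; apply: ideal_gen0.
- by move=> q q' Iq Iq'; rewrite mulrDr; apply: ideal_genD.
move=> c _ [A [sAB cA ->]]; rewrite mulrCA; apply: ideal_genMl.
have iA : i \notin A by apply/negP => /(subsetP sAB); rewrite !inE eqxx.
exists (i |: A); split; last by rewrite big_setU1.
  rewrite subUset sub1set iB; apply: subset_trans sAB _; exact: subsetDl.
by rewrite cardsU1 iA cA.
Qed.

(** From a set of indices avoiding [l j] one drops [i] if it is there, and any
    element otherwise. *)
Lemma avoids_setD1 B e i j : avoids B e.+1 j -> avoids (B :\ i) e j.
Proof.
case/existsP=> A /and3P[sAB /eqP cA nz].
have [k kA ik] : exists2 k, k \in A & i \in A -> i = k.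
  have [iA|_] := boolP (i \in A); first by exists i.
  have /card_gt0P[k kA] : (0 < #|A|)%N by rewrite cA.
  by exists k.
apply/existsP; exists (A :\ k); apply/and3P; split.
- apply/subsetP => m; rewrite !inE => /andP[mk mA]; rewrite (subsetP sAB) // andbT.
  by apply: contraNneq mk => mi; rewrite -ik // -mi.
- by rewrite -eqSS -cA (cardsD1 k A) kA.
by move: nz; rewrite (big_setD1 k) //= mevalM mulf_eq0 negb_or => /andP[].
Qed.

(** By induction the ideal contains l_i R_(e-1) for some i; any form F of
    degree e is in this space up to a multiple of one product that does not
    vanish at the zero of l_i. *)
Lemma subset_ideal_full B e F : (e <= #|B|)%N ->
  (forall i, i \in B -> avoids B e i) -> F \is e.-homog ->
  ideal_gen (subset_product B e) F.
Proof.
elim: e B F => [|e IHa] B F leaB avB hF.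
  have [c ->] := dhomog0_const hF.
  rewrite -[c%:MP]mulr1; apply: ideal_genMl; exists set0.
  by rewrite sub0set cards0 big_set0.
have /card_gt0P[i iB] : (0 < #|B|)%N by apply: leq_trans leaB.
have /existsP[A /and3P[sAB /eqP cA nz]] := avB i iB.
set P := \prod_(j in A) l j in nz; set x := zero_pt (l i) in nz.
have hP : P \is e.+1.-homog by rewrite -cA; apply: dhomog_prod_lin.
have [Q [hQ eQ]] : exists Q : R, Q \is e.-homog /\
    F - (F.@[x] / P.@[x])%:MP * P = l i * Q.
  apply: linear_dvd => //; last by rewrite mevalB mevalM mevalC divfK ?subrr.
  by rewrite rpredB // mul_mpolyC dhomogZ.
rewrite -[F](subrK ((F.@[x] / P.@[x])%:MP * P)) eQ; apply: ideal_genD.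
  apply: subset_ideal_step => //; apply: IHa => //.
    by move: leaB; rewrite (cardsD1 i B) iB.
  by move=> j; rewrite !inE => /andP[_ jB]; apply/avoids_setD1/avB.
by apply: ideal_genMl; exists A.
Qed.

(** The ideal of [e]-fold products is g m^r, where g is their greatest common
    divisor: a form dividing all of them is split off, until none is left. *)
Lemma subset_ideal_gcd B e : (e <= #|B|)%N ->
  exists d r g, [/\ g != 0, g \is d.-homog, (d + r = e)%N,
    (forall p, subset_product B e p -> exists Q, Q \is r.-homog /\ p = g * Q)
    & forall Q, Q \is r.-homog -> ideal_gen (subset_product B e) (g * Q)].
Proof.
elim: e B => [|e IHa] B leaB.
  exists 0%N, 0%N, 1; split=> //; first exact: oner_neq0; first exact: dhomog1.
    move=> p [A [_ /eqP]]; rewrite cards_eq0 => /eqP -> ->.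
    by exists 1; rewrite big_set0 mulr1 dhomog1.
  move=> Q _; rewrite mulrC; apply: ideal_genMl; exists set0.
  by rewrite sub0set cards0 big_set0.
have [/forall_inP avB|] := boolP [forall i in B, avoids B e.+1 i].
  exists 0%N, e.+1, 1; split=> //; first exact: oner_neq0; first exact: dhomog1.
    move=> _ [A [_ cA ->]]; exists (\prod_(j in A) l j); rewrite mul1r -cA.
    by split=> //; apply: dhomog_prod_lin.
  by move=> Q hQ; rewrite mul1r; apply: subset_ideal_full.
rewrite negb_forall_in => /exists_inP[i iB nav].
have [|d [r [g [g0 hg dr dvdg spang]]]] := IHa (B :\ i).
  by move: leaB; rewrite (cardsD1 i B) iB.
exists d.+1, r, (l i * g); split.
- by rewrite mulf_neq0.
- by rewrite -[d.+1]add1n; apply: dhomogM.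
- by rewrite addSn dr.
- move=> _ [A [sAB cA ->]].
  (* The factor of the product to be traded for l_i: i itself if it occurs, or
     else an index whose form vanishes at the zero of l_i. *)
  have [j [jA sABi [q [hq lj]]]] : exists j, [/\ j \in A, A :\ j \subset B :\ i &
      exists q : R, q \is 0.-homog /\ l j = l i * q].
    have [iA|iA] := boolP (i \in A).
      by exists i; split; [|apply: setSD|exists 1; rewrite mulr1 dhomog1].
    have : (\prod_(j in A) l j).@[zero_pt (l i)] == 0.
      apply: contraNT nav => nz; apply/existsP; exists A.
      by rewrite sAB cA eqxx.
    rewrite rmorph_prod prodf_seq_eq0 => /hasP[j _ /andP[jA /eqP lj0]].
    exists j; split=> //; last exact: linear_dvd.
    by rewrite subsetD1 (subset_trans _ sAB) ?subD1set // !inE negb_and iA orbT.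
  have [|Q [hQ eQ]] := dvdg (\prod_(k in A :\ j) l k).
    exists (A :\ j); split=> //; apply/eqP.
    by rewrite -eqSS -cA (cardsD1 j A) jA.
  exists (q * Q); split; first by rewrite -[r]add0n; apply: dhomogM.
  by rewrite (big_setD1 j) //= lj eQ; ring.
by move=> Q hQ; rewrite -mulrA; apply/subset_ideal_step/spang.
Qed.

End SubsetProducts.

(** * Syzygies of the powers of a regular sequence *)

Section PowerSyzygies.
Variables (R : idomainType) (x y : R).
Hypotheses (x_neq0 : x != 0) (y_neq0 : y != 0).
Hypothesis xy_regular : forall p q, p * x = q * y -> exists u, p = u * y.

Lemma regular_exp n p q : p * x ^+ n = q * y -> exists u, p = u * y.
Proof.
elim: n p q => [|n IHn] p q; first by rewrite mulr1; exists q.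
rewrite exprS mulrA => /IHn[u /xy_regular]; exact.
Qed.

(** Modulo y only the last term v_r x^r of the relation survives, and x is
    regular modulo y, so v_r = u y.
    Subtracting u times the syzygy between the last two monomials moves u x to
    the coefficient r - 1; after division by y this is a relation in degree
    r - 1. *)
Lemma power_syzygy r (v : nat -> R) :
  \sum_(j < r.+1) v j * (x ^+ j * y ^+ (r - j)) = 0 ->
  exists w : nat -> R, forall j, (j <= r)%N ->
    v j = (if j is j'.+1 then w j' * y else 0) - (if (j < r)%N then w j * x else 0).
Proof.
elim: r v => [|r IHr] v.
  rewrite big_ord1 subnn mulr1 => /eqP; rewrite mulr1 => /eqP v0.
  by exists (fun=> 0) => -[|] // _; rewrite v0 subrr.
rewrite big_ord_recr /= subnn mulr1.
have -> : \sum_(j < r.+1) v j * (x ^+ j * y ^+ (r.+1 - j)) =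
    (\sum_(j < r.+1) v j * (x ^+ j * y ^+ (r - j))) * y.
  rewrite mulr_suml; apply: eq_bigr => j _.
  by rewrite subSn ?leq_ord // exprSr !mulrA.
move=> e0.
have [u eu] : exists u, v r.+1 = u * y.
  apply: (@regular_exp r.+1 _ (- \sum_(j < r.+1) v j * (x ^+ j * y ^+ (r - j)))).
  by apply/eqP; rewrite mulNr -addr_eq0 addrC e0.
have [|w hw] := IHr (fun j => if j == r then v r + u * x else v j).
  apply: (mulIf y_neq0); rewrite mul0r -[RHS]e0 eu.
  rewrite !big_ord_recr /= eqxx subnn.
  have -> : \sum_(i < r) (if i == r :> nat then v r + u * x else v i) * (x ^+ i * y ^+ (r - i))
    = \sum_(i < r) v i * (x ^+ i * y ^+ (r - i)).
    by apply: eq_bigr => j _; rewrite ltn_eqF.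
  by rewrite exprS; ring.
exists (fun j => if j == r then u else w j) => j; rewrite leq_eqVlt ltnS.
case/orP=> [/eqP->|jr]; first by rewrite eqxx ltnn subr0.
rewrite jr; have := hw j jr; move: jr; rewrite leq_eqVlt.
case/orP=> [/eqP->|jr]; last first.
  rewrite jr ltn_eqF // => ->; case: j jr => // j jr.
  by rewrite ltn_eqF // ltnW.
rewrite ltnn eqxx subr0 => /(canRL (addrK _)) ->.
by case: (r) => // s; rewrite ltn_eqF.
Qed.

Lemma power_syzygy_inj r (w : nat -> R) :
  (forall j, (j <= r)%N ->
    (if j is j'.+1 then w j' * y else 0) - (if (j < r)%N then w j * x else 0) = 0) ->
  forall j, (j < r)%N -> w j = 0.
Proof.
move=> hw; elim=> [|j IHj] jr; have := hw _ (ltnW jr); rewrite jr.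
  by rewrite sub0r => /eqP; rewrite oppr_eq0 mulf_eq0 (negPf x_neq0) orbF => /eqP.
rewrite IHj ?(ltnW jr) // mul0r sub0r.
by move/eqP; rewrite oppr_eq0 mulf_eq0 (negPf x_neq0) orbF => /eqP.
Qed.

End PowerSyzygies.

(** * Powers of the ideal (x, y) *)

Section PowerOfMaximalIdeal.
Variable K : fieldType.
Local Notation R := {mpoly K[2]}.
Local Notation x := ('X_0 : R).
Local Notation y := ('X_1 : R).

Lemma mpolyX2 (m : 'X_{1..2}) : 'X_[m] = x ^+ m 0 * y ^+ m 1.
Proof.
rewrite mpolyXE_id big_ord_recl big_ord1.
by rewrite (_ : lift ord0 ord0 = 1) //; apply: val_inj.
Qed.

Lemma mpolyX_neq0 k : ('X_k : R) != 0.
Proof.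
apply/eqP => /(congr1 (mcoeff U_(k))) /eqP.
by rewrite mcoeffX eqxx mcoeff0 oner_eq0.
Qed.

(** Substituting 0 for y turns the equation into p(x, 0) x = 0, so that
    p = p - p(x, 0), which is divisible by y. *)
Lemma X0_X1_regular (p q : R) : p * x = q * y -> exists u, p = u * y.
Proof.
pose phi : {rmorphism R -> R} := comp_mpoly [tuple x; 0].
have phix : phi x = x by rewrite /phi /= comp_mpolyXU.
have phiy : phi y = 0 by rewrite /phi /= comp_mpolyXU.
have phiC c : phi c%:MP = c%:MP by rewrite /phi /= comp_mpolyC.
(* Any ring morphism with these values serves below. *)
move: phi phix phiy phiC => phi phix phiy phiC.
have hphi s : exists u, s = phi s + u * y.
  rewrite [s]mpolyE; apply: (big_ind (fun s => exists u, s = phi s + u * y)).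
  - by exists 0; rewrite rmorph0 mul0r addr0.
  - move=> s1 s2 [u e1] [u' e2]; exists (u + u').
    by rewrite rmorphD mulrDl addrACA -e1 -e2.
  move=> m _; rewrite -mul_mpolyC mpolyX2 !rmorphM !rmorphXn phix phiy phiC.
  case: (m 1) => [|j]; first by exists 0; rewrite !expr0 mul0r addr0.
  exists ((s@_m)%:MP * x ^+ m 0 * y ^+ j).
  by rewrite expr0n !mulr0 add0r exprSr !mulrA.
move=> e; have [u eu] := hphi p; exists u.
suff p0 : phi p = 0 by rewrite eu p0 add0r.
have /eqP := congr1 phi e; rewrite !rmorphM phix phiy mulr0 mulf_eq0.
by rewrite (negPf (mpolyX_neq0 0)) orbF => /eqP.
Qed.

Lemma dhomog_powers r (Q : R) : Q \is r.-homog ->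
  exists c : 'I_r.+1 -> R, Q = \sum_(j < r.+1) c j * (x ^+ j * y ^+ (r - j)).
Proof.
move=> hQ; rewrite [Q]mpolyE big_seq.
apply: (big_ind (fun Q : R => exists c : 'I_r.+1 -> R,
  Q = \sum_(j < r.+1) c j * (x ^+ j * y ^+ (r - j)))).
- by exists (fun=> 0); rewrite big1 // => j _; rewrite mul0r.
- move=> _ _ [c ->] [d ->]; exists (fun j => c j + d j).
  by rewrite -big_split; apply: eq_bigr => j _; rewrite mulrDl.
move=> m mQ; have dm : mdeg m = r := dhomog_mf hQ mQ.
move: dm; rewrite mdegE big_ord_recl big_ord1.
rewrite (_ : lift ord0 ord0 = 1) => [dm|]; last exact: val_inj.
have lt0r : (m 0%R < r.+1)%N by rewrite ltnS -dm leq_addr.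
exists (fun j => if j == Ordinal lt0r then (Q@_m)%:MP else 0).
rewrite (bigD1 (Ordinal lt0r)) //= eqxx big1 ?addr0; last first.
  by move=> j /negPf ->; rewrite mul0r.
by rewrite mul_mpolyC mpolyX2 -dm addKn.
Qed.

Lemma dhomog_monomial2 i j : x ^+ i * y ^+ j \is (i + j).-homog.
Proof.
by apply: dhomogM; rewrite -[X in X.-homog]mul1n; apply/dhomogMn/dhomogXi.
Qed.

End PowerOfMaximalIdeal.

(** * The resolution of a multiple of a power of (x, y) *)

Section Resolution.
Variable K : fieldType.
Local Notation R := {mpoly K[2]}.
Local Notation x := ('X_0 : R).
Local Notation y := ('X_1 : R).

Lemma shifted_homog0 s e : shifted_homog s e (0 : R).
Proof. by rewrite /shifted_homog; case: ifP => // _; apply: dhomog0. Qed.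

Lemma shifted_homogD s e (p q : R) :
  shifted_homog s e p -> shifted_homog s e q -> shifted_homog s e (p + q).
Proof.
rewrite /shifted_homog; case: ifP => _; first exact: dhomogD.
by move=> -> ->; rewrite addr0.
Qed.

Lemma shifted_homogM s t e (p q : R) :
  shifted_homog (s + t) e p -> q \is t.-homog -> shifted_homog s e (p * q).
Proof.
rewrite /shifted_homog => hp hq; move: hp; case: ifP => [le_st|_ ->]; last first.
  by rewrite mul0r; case: ifP => // _; apply: dhomog0.
have le_s := leq_trans (leq_addr t s) le_st; rewrite le_s => hp.
have le_t : (t <= e - s)%N by rewrite leq_subRL.
by rewrite -(subnK le_t) -subnDA; apply: dhomogM.
Qed.

Definition syz_rank (r i : nat) : nat :=
  match i with 0%N => r.+1 | 1%N => r | _ => 0%N end.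

(** Row k is the syzygy y e_(k+1) - x e_k between the monomials x^k y^(r-k) and
    x^(k+1) y^(r-k-1). *)
Definition syz_entry (k l : nat) : R :=
  (if k.+1 == l then y else 0) - (if k == l then x else 0).

(** For [i > 0] these matrices have no rows and represent the zero maps on the
    left of the resolution. *)
Definition syz_matrix r i : 'M[R]_(syz_rank r i.+1, syz_rank r i) :=
  \matrix_(k, l) syz_entry k l.

Lemma syz_entry_homog k l : syz_entry k l \is 1.-homog.
Proof.
by rewrite /syz_entry; apply: rpredB; case: ifP => _; rewrite ?dhomog0 ?dhomogXi.
Qed.

Lemma sum_if_eq n (F : nat -> R) i :
  \sum_(j < n) (if val j == i then F j else 0) = if (i < n)%N then F i else 0.
Proof. by rewrite -big_mkcond /= big_ord1_eq. Qed.

Lemma sum_syz_entry r (w : nat -> R) l :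
  (l <= r)%N -> \sum_(k < r) w k * syz_entry k l =
  (if l is l'.+1 then w l' * y else 0) - (if (l < r)%N then w l * x else 0).
Proof.
move=> lr; under eq_bigr do rewrite mulrBr.
rewrite sumrB -(sum_if_eq _ (fun k => w k * x)); congr (_ - _); last first.
  by apply: eq_bigr => k _; case: ifP; rewrite ?mulr0.
case: l lr => [_|l lr]; first by rewrite big1 // => k _; rewrite mulr0.
transitivity (\sum_(k < r) (if val k == l then w k * y else 0)).
  by apply: eq_bigr => k _; rewrite eqSS; case: ifP; rewrite ?mulr0.
by rewrite (sum_if_eq _ (fun k => w k * y)) lr.
Qed.

Lemma sum_entry_syz r (F : nat -> R) k :
  (k < r)%N -> \sum_(j < r.+1) syz_entry k j * F j = y * F k.+1 - x * F k.
Proof.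
move=> kr; under eq_bigr do rewrite mulrBl.
have sumE (z : R) i : (i < r.+1)%N ->
    \sum_(j < r.+1) (if i == j then z else 0) * F j = z * F i.
  move=> ir; transitivity (\sum_(j < r.+1) (if val j == i then z * F j else 0)).
    by apply: eq_bigr => j _; rewrite eq_sym; case: ifP; rewrite ?mul0r.
  by rewrite (sum_if_eq _ (fun j => z * F j)) ir.
by rewrite sumrB !sumE // ltnS ltnW.
Qed.

Definition aug (g : R) r (v : 'rV[R]_r.+1) : R :=
  \sum_(j < r.+1) v 0 j * (g * (x ^+ j * y ^+ (r - j))).

Lemma aug_is_linear g r : linear (@aug g r : 'rV[R]_r.+1 -> R^o).
Proof.
move=> c u v; rewrite /aug scaler_sumr -big_split; apply: eq_bigr => j _.
by rewrite !mxE mulrDl -mulrA.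
Qed.

HB.instance Definition _ g r :=
  GRing.isLinear.Build R 'rV[R]_r.+1 R^o _ (@aug g r) (@aug_is_linear g r).

(** Rows extended by zero to all of nat, so that the syzygies can be handled by
    induction on the length without dependent types. *)
Definition row_fun r (w : 'rV[R]_r) (k : nat) : R :=
  if insub k is Some i then w 0 i else 0.

Lemma row_funE r (w : 'rV[R]_r) (k : 'I_r) : row_fun w k = w 0 k.
Proof. by rewrite /row_fun valK. Qed.

Lemma mul_syz_matrix r (w : 'rV[R]_r) (l : 'I_r.+1) :
  (w *m syz_matrix r 0) 0 l =
  (if val l is l'.+1 then row_fun w l' * y else 0)
    - (if (l < r)%N then row_fun w l * x else 0).
Proof.
rewrite -sum_syz_entry ?leq_ord // !mxE; apply: eq_bigr => k _.
by rewrite !mxE row_funE.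
Qed.

Lemma aug_syz_exact g r (v : 'rV[R]_r.+1) : g != 0 ->
  aug g v = 0 <-> exists w, w *m syz_matrix r 0 = v.
Proof.
move=> g0; have augE (u : 'rV[R]_r.+1) :
    aug g u = g * \sum_(j < r.+1) row_fun u j * (x ^+ j * y ^+ (r - j)).
  by rewrite /aug mulr_sumr; apply: eq_bigr => j _; rewrite row_funE mulrCA.
split=> [/eqP|[w <-]].
  rewrite augE mulf_eq0 (negPf g0) => /eqP.
  move/(power_syzygy (mpolyX_neq0 _ 1) (@X0_X1_regular K)) => [w hw].
  exists (\row_k w k); apply/rowP => l; rewrite -[RHS]row_funE hw ?leq_ord //.
  rewrite -sum_syz_entry ?leq_ord // !mxE; apply: eq_bigr => k _.
  by rewrite !mxE.
rewrite /aug; under eq_bigr do rewrite mxE mulr_suml.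
rewrite exchange_big big1 //= => k _.
transitivity (w 0 k * g * \sum_(j < r.+1) syz_entry k j * (x ^+ j * y ^+ (r - j))).
  by rewrite mulr_sumr; apply: eq_bigr => j _; rewrite mxE /=; ring.
rewrite (sum_entry_syz (fun j => x ^+ j * y ^+ (r - j)) (ltn_ord k)).
by rewrite -(subnSK (ltn_ord k)) !exprS; ring.
Qed.

Lemma syz_inj r (v : 'rV[R]_r) : v *m syz_matrix r 0 = 0 -> v = 0.
Proof.
move=> /rowP v0; apply/rowP => k; rewrite mxE -row_funE.
apply: (power_syzygy_inj (mpolyX_neq0 _ 0) (y := y) (r := r)) => // j jr.
by have := v0 (Ordinal (jr : (j < r.+1)%N)); rewrite mul_syz_matrix mxE.
Qed.

Lemma multiple_of_power_resolution (I : R -> Prop) g d r :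
  g != 0 -> g \is d.-homog -> generated_in_degree (d + r) I ->
  (forall p, I p <-> exists c : 'I_r.+1 -> R,
     p = \sum_(j < r.+1) c j * (g * (x ^+ j * y ^+ (r - j)))) ->
  has_linear_resolution I.
Proof.
move=> g0 hg genI IE; right; exists (d + r)%N, 1%N; split=> //.
exists (syz_rank r), (@aug g r), (fun i => mulmxr (syz_matrix r i)); split.
- by case=> [|[]].
- split=> [e v hv|i e v hv].
    apply: big_ind => [||j _]; first exact: shifted_homog0.
      by move=> p q; apply: shifted_homogD.
    apply: shifted_homogM; first exact: hv.
    apply: dhomogM => //; rewrite -[X in X.-homog](subnKC (leq_ord j)).
    exact: dhomog_monomial2.
  move=> j; rewrite mxE; apply: big_ind => [||k _]; first exact: shifted_homog0.
    by move=> p q; apply: shifted_homogD.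
  apply: (@shifted_homogM _ 1); first by rewrite addn1 -addnS; apply: hv.
  by rewrite mxE; apply: syz_entry_homog.
- move=> p; rewrite IE; split=> [[c ->]|[v <-]].
    by exists (\row_j c j); apply: eq_bigr => j _; rewrite mxE.
  by exists (fun j => v 0 j).
- by move=> v; apply: aug_syz_exact.
have rV0 i (v : 'rV[R]_(syz_rank r i.+2)) : v = 0 by apply/rowP => -[].
case=> [|i] v /=; split.
- by move/syz_inj=> ->; exists 0; rewrite mul0mx.
- by case=> w <-; rewrite (rV0 0%N w) !mul0mx.
- by move=> _; exists 0; rewrite mul0mx [RHS]rV0.
- by move=> _; rewrite [v]rV0 mul0mx.
Qed.

End Resolution.

(** * Linearity of the resolution of ideals of a-fold products *)

Theorem theorem2p2 (K : fieldType) (charK0 : [pchar K] =i pred0)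
    (n : nat) (Sigma : n.-tuple {mpoly K[2]})
    (hSigma : forall i : 'I_n,
       linear_form (tnth Sigma i) /\ tnth Sigma i <> 0)
    (a : nat) (ha : (1 <= a <= n)%N) :
  has_linear_resolution (fold_ideal Sigma a).
Proof.
have lin i : tnth Sigma i \is 1.-homog by case: (hSigma i).
have nz i : tnth Sigma i != 0 by apply/eqP; case: (hSigma i).
have foldP p : fold_product Sigma a p <-> subset_product (tnth Sigma) setT a p.
  by split=> [[A [cA ->]]|[A [_ cA ->]]]; exists A; rewrite ?subsetT.
have [|d [r [g [g0 hg da dvdg spang]]]] := @subset_ideal_gcd _ _ _ lin nz setT a.
  by rewrite cardsT card_ord; case/andP: ha.
apply: (multiple_of_power_resolution (d := d) (r := r) g0 hg).
  exists (fold_product Sigma a); split=> // p [A [cA ->]].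
  by rewrite da -cA; apply: dhomog_prod_lin.
move=> p; split.
  apply: (ideal_gen_sub (J := fun p => exists c : 'I_r.+1 -> {mpoly K[2]},
    p = \sum_(j < r.+1) c j * (g * ('X_0 ^+ j * 'X_1 ^+ (r - j))))).
  - by exists (fun=> 0); rewrite big1 // => j _; rewrite mul0r.
  - move=> _ _ [c1 ->] [c2 ->]; exists (fun j => c1 j + c2 j).
    by rewrite -big_split; apply: eq_bigr => j _; rewrite mulrDl.
  move=> c q /foldP/dvdg[Q [/dhomog_powers[c' ->] ->]].
  exists (fun j => c * c' j); rewrite !mulr_sumr; apply: eq_bigr => j _; ring.
case=> c ->; apply: big_ind => [||j _]; first exact: ideal_gen0.
  by move=> q q'; apply: ideal_genD.
apply: ideal_genM; have [|m [b [h [hh ->]]]] := spang ('X_0 ^+ j * 'X_1 ^+ (r - j)).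
  by rewrite -[X in X.-homog](subnKC (leq_ord j)); apply: dhomog_monomial2.
by exists m, b, h; split=> // i; apply/foldP.
Qed.
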